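(* Let $(\bar M,\phi,\xi,\eta,g)$ be a nearly trans-Sasakian manifold of type $(\alpha,\beta)$. There do not exist warped product semi-slant submanifolds of the type $M=N_\theta\times_f N_T$ of $\bar M$ such that $\xi$ is tangent to $N_\theta$, unless $\bar M$ is nearly $\beta$-Kenmotsu (that is, unless $\alpha=0$).
   Context: An almost contact metric manifold is a $(2m+1)$-dimensional smooth manifold $\bar M$ with a $(1,1)$-tensor field $\phi$, a vector field $\xi$, a $1$-form $\eta$ and a Riemannian metric $g$ satisfying $\phi^2=-I+\eta\otimes\xi$, $\phi\xi=0$, $\eta\circ\phi=0$, $\eta(\xi)=1$, $\eta(X)=g(X,\xi)$ and $g(\phi X,\phi Y)=g(X,Y)-\eta(X)\eta(Y)$ for all vector fields $X,Y$ on $\bar M$. Let $\bar\nabla$ be the Levi-Civita connection of $g$. The structure is nearly trans-Sasakian of type $(\alpha,\beta)$ ($\alpha,\beta$ smooth functions on $\bar M$) if for all vector fields $X,Y$ on $\bar M$ $$(\bar\nabla_X\phi)Y+(\bar\nabla_Y\phi)X=\alpha\big(2g(X,Y)\xi-\eta(Y)X-\eta(X)Y\big)-\beta\big(\eta(Y)\phi X+\eta(X)\phi Y\big).$$ It is nearly ($\beta$-)Kenmotsu when $\alpha=0$. For Riemannian manifolds $(N_1,g_1)$, $(N_2,g_2)$ and a positive differentiable function $f$ on $N_1$, the warped product $N_1\times_f N_2$ is the product manifold $N_1\times N_2$ with the metric $\|X\|^2=\|\pi_{1\star}X\|^2+(f\circ\pi_1)^2\|\pi_{2\star}X\|^2$,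 where $\pi_1,\pi_2$ are the projections. A warped product semi-slant submanifold of type $N_\theta\times_f N_T$ is a submanifold $M$ of $\bar M$, with $\xi$ tangent to $M$, which with the induced metric is a warped product $N_\theta\times_f N_T$ whose factors are of positive dimension and such that: $N_T$ is an invariant submanifold ($\phi(TN_T)\subseteq TN_T$), and $N_\theta$ is a proper slant submanifold with slant angle $\theta\in(0,\pi/2)$, i.e. for every nonzero vector $X$ tangent to $N_\theta$ and not proportional to $\xi$, the angle between $\phi X$ and the tangent space of $N_\theta$ is the constant $\theta$. ''$\xi$ is tangent to $N_\theta$'' means that along $M$ the vector field $\xi$ lies in the subbundle of $TM$ tangent to the factor $N_\theta$.
   Formalization: The conclusion is that α vanishes at every point of the submanifold M, rather than on all of the ambient manifold; the global claim fails, since the hypotheses do not constrain α away from M. *)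

(* Defs.v *)
From HB Require Import structures.
From mathcomp Require Import all_boot all_order all_algebra.
From mathcomp Require Import all_classical all_reals all_analysis.
Set Implicit Arguments.
Unset Strict Implicit.
Unset Printing Implicit Defensive.
Import Order.TTheory GRing.Theory Num.Theory.
Import numFieldNormedType.Exports.
Local Open Scope classical_set_scope.
Local Open Scope ring_scope.

Section Smooth.
Context {R : realType} {n : nat} {V : normedModType R}.
Implicit Types (U : set 'rV[R]_n) (f : 'rV[R]_n -> V).

(* f is of class C^(k+1) on the open set U iff it is Frechet differentiable on U
   and all its directional derivatives are of class C^k on U. *)
Fixpoint Ck (k : nat) U f : Prop :=
  match k with
  | 0 => forall x, U x -> {for x, continuous f}
  | k.+1 => (forall x, U x -> differentiable f x) /\
            (forall v, Ck k U ('D_v f))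
  end.

Definition smooth_on U f := forall k, Ck k U f.

Definition smooth_at f x := exists U, [/\ open U, U x & smooth_on U f].

Lemma near_eq_differentiable f f' x :
  (\forall y \near x, f y = f' y) -> differentiable f x -> differentiable f' x.
Proof.
move=> e df.
have nb : \forall y \near 0, f (y + x) = f' (y + x).
  by move: e; rewrite (near_shift 0) subr0; apply: filterS.
have h : f' \o shift x = cst (f' x) + 'd f x +o_ 0 id.
  apply/eqaddoP => _/posnumP[r]; move/diff_locally/eqaddoP: df => /(_ r%:num (gt0 _)).
  apply: filterS2 nb => y ey.
  by rewrite !fctE /cst /shift /= -ey (nbhs_singleton e).
have c : continuous ('d f x) by exact: diff_continuous.
have E := diff_unique c h.
by apply/diff_locallyP; rewrite E; split.
Qed.

Lemma Ck_ext k U f f' : open U -> {in U, f =1 f'} -> Ck k U f -> Ck k U f'.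
Proof.
elim: k f f' => [|k IH] f f' oU ff'.
  move=> fc x Ux; have e : \forall y \near x, f y = f' y.
    by apply: filterS (open_nbhs_nbhs (conj oU Ux)) => y Uy; apply/ff'/mem_set.
  rewrite /prop_for /continuous_at -(nbhs_singleton e).
  exact/(cvg_trans (near_eq_cvg e))/fc.
have e y : U y -> \forall z \near y, f z = f' z.
  move=> Uy; apply: filterS (open_nbhs_nbhs (conj oU Uy)) => z Uz.
  exact/ff'/mem_set.
move=> [df Df]; split=> [x Ux|v]; first exact: near_eq_differentiable (e x Ux) (df x Ux).
apply: IH (Df v) => // x /set_mem Ux; apply: near_eq_derive; exact: e.
Qed.

End Smooth.

Section ProductSmooth.
Context {R : realType} {n1 n2 m1 m2 : nat}.
Implicit Types (A : set 'rV[R]_n1) (B : set 'rV[R]_n2).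

Definition prod_set A B : set 'rV[R]_(n1 + n2) :=
  [set x | A (lsubmx x) /\ B (rsubmx x)].

Definition prod_fun (f1 : 'rV[R]_n1 -> 'rV[R]_m1) (f2 : 'rV[R]_n2 -> 'rV[R]_m2) :
    'rV[R]_(n1 + n2) -> 'rV[R]_(m1 + m2) :=
  fun x => row_mx (f1 (lsubmx x)) (f2 (rsubmx x)).

Lemma open_prod_set A B : open A -> open B -> open (prod_set A B).
Proof.
move=> o1 o2; apply: (@openI _ (lsubmx @^-1` A) (rsubmx @^-1` B)).
  by apply: open_comp => // x _; exact: continuous_lsubmx.
by apply: open_comp => // x _; exact: continuous_rsubmx.
Qed.

Lemma row_mx_cvg (T : Type) (F : set_system T) (FF : Filter F)
    (f : T -> 'rV[R]_m1) (g : T -> 'rV[R]_m2) (a : 'rV[R]_m1) (b : 'rV[R]_m2) :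
  f @ F --> a -> g @ F --> b ->
  (fun t => row_mx (f t) (g t) : 'rV[R]_(m1 + m2)) @ F --> (row_mx a b : 'rV[R]_(m1 + m2)).
Proof.
move=> fa gb; apply/cvg_ballP => e e0.
move/cvg_ballP: fa => /(_ _ e0) fa; move/cvg_ballP: gb => /(_ _ e0) gb.
apply: filterS2 fa gb => t; rewrite /ball/= => -[_ fa] [_ gb]; split=> // i j.
by rewrite !mxE; case: (fintype.split j) => k; [exact: fa|exact: gb].
Qed.

Lemma prod_fun_continuous f1 f2 x :
  {for lsubmx x, continuous f1} -> {for rsubmx x, continuous f2} ->
  {for x, continuous (prod_fun f1 f2)}.
Proof.
move=> c1 c2; apply: (@row_mx_cvg _ (nbhs x) _ (f1 \o lsubmx) (f2 \o rsubmx)).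
  exact: cvg_comp (@continuous_lsubmx _ _ _ _ x) c1.
exact: cvg_comp (@continuous_rsubmx _ _ _ _ x) c2.
Qed.

Lemma prod_fun_differentiable f1 f2 x :
  differentiable f1 (lsubmx x) -> differentiable f2 (rsubmx x) ->
  differentiable (prod_fun f1 f2) x.
Proof.
move=> d1 d2.
pose i1 (u : 'rV[R]_m1) : 'rV[R]_(m1 + m2) := row_mx u 0.
pose i2 (u : 'rV[R]_m2) : 'rV[R]_(m1 + m2) := row_mx 0 u.
have l1 : linear i1 by move=> a u v; rewrite /i1 scale_row_mx add_row_mx scaler0 addr0.
have l2 : linear i2 by move=> a u v; rewrite /i2 scale_row_mx add_row_mx scaler0 addr0.
have c1 : continuous i1.
  by move=> u; apply: (@row_mx_cvg _ (nbhs u) _ id (cst 0)); [exact: cvg_id|exact: cvg_cst].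
have c2 : continuous i2.
  by move=> u; apply: (@row_mx_cvg _ (nbhs u) _ (cst 0) id); [exact: cvg_cst|exact: cvg_id].
pose I1 := HB.pack_for {linear 'rV[R]_m1 -> 'rV[R]_(m1 + m2)} i1
  (GRing.isLinear.Build _ _ _ _ _ l1).
pose I2 := HB.pack_for {linear 'rV[R]_m2 -> 'rV[R]_(m1 + m2)} i2
  (GRing.isLinear.Build _ _ _ _ _ l2).
have -> : prod_fun f1 f2 = (I1 \o (f1 \o lsubmx)) \+ (I2 \o (f2 \o rsubmx)).
  by apply/funext => y /=; rewrite add_row_mx addr0 add0r.
apply: differentiableD; (apply: differentiable_comp; last exact: linear_differentiable).
  by apply: differentiable_comp => //; exact: differentiable_lsubmx.
by apply: differentiable_comp => //; exact: differentiable_rsubmx.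
Qed.

Lemma prod_fun_derive f1 f2 x v :
  differentiable f1 (lsubmx x) -> differentiable f2 (rsubmx x) ->
  'D_v (prod_fun f1 f2) x = prod_fun ('D_(lsubmx v) f1) ('D_(rsubmx v) f2) x.
Proof.
move=> d1 d2; apply: cvg_lim => //.
rewrite [X in X @ _ --> _](_ : _ = fun h => row_mx
    (h^-1 *: (f1 (h *: lsubmx v + lsubmx x) - f1 (lsubmx x)))
    (h^-1 *: (f2 (h *: rsubmx v + rsubmx x) - f2 (rsubmx x)))).
  by apply: row_mx_cvg; exact: diff_derivable.
apply/funext => h /=; rewrite /prod_fun opp_row_mx add_row_mx scale_row_mx.
by rewrite !linearD !linearZ.
Qed.

Lemma prod_fun_Ck k A B f1 f2 : open A -> open B ->
  Ck k A f1 -> Ck k B f2 -> Ck k (prod_set A B) (prod_fun f1 f2).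
Proof.
move=> o1 o2; elim: k f1 f2 => [|k IH] f1 f2.
  by move=> c1 c2 x [? ?]; apply: prod_fun_continuous; [exact: c1|exact: c2].
move=> [d1 D1] [d2 D2]; split=> [x [? ?]|v].
  by apply: prod_fun_differentiable; [exact: d1|exact: d2].
apply: Ck_ext (IH _ _ (D1 (lsubmx v)) (D2 (rsubmx v))); first exact: open_prod_set.
by move=> x /set_mem[? ?]; rewrite prod_fun_derive//; [exact: d1|exact: d2].
Qed.

End ProductSmooth.

(* The atlas is indexed by the points of the manifold: `chart p` is a chart
   around p, with domain `chart_dom p`, and `param p` is its inverse. The
   functions `chart p` and `param p` are total; their values outside
   `chart_dom p` and its image are irrelevant. *)
Record manifold (R : realType) (n : nat) := Manifold {
  carrier :> topologicalType;
  chart_dom : carrier -> set carrier;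
  chart : carrier -> carrier -> 'rV[R]_n;
  param : carrier -> 'rV[R]_n -> carrier;
  manifold_hausdorff : hausdorff_space carrier;
  manifold_second_countable : @second_countable carrier;
  chart_dom_open : forall p, open (chart_dom p);
  chart_dom_self : forall p, chart_dom p p;
  chart_img_open : forall p, open (chart p @` chart_dom p);
  chartK : forall p q, chart_dom p q -> param p (chart p q) = q;
  chart_continuous : forall p q, chart_dom p q ->
    {for q, continuous (chart p)};
  param_continuous : forall p q, chart_dom p q ->
    {for chart p q, continuous (param p)};
  transition_smooth : forall p q,
    smooth_on (chart p @` (chart_dom p `&` chart_dom q)) (chart q \o param p)
}.

Section ProductManifold.
Context {R : realType} {n1 n2 : nat}.

Lemma transition_open n (M : manifold R n) (p q : M) :
  open (chart p @` (chart_dom p `&` chart_dom q)).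
Proof.
rewrite openE => _ [r [pr qr] <-].
have o : nbhs (chart p r) (chart p @` chart_dom p).
  by apply: open_nbhs_nbhs; split; [exact: chart_img_open|exists r].
have c : nbhs (chart p r) (param p @^-1` chart_dom q).
  apply: (param_continuous pr); rewrite chartK//.
  by apply: open_nbhs_nbhs; split=> //; exact: chart_dom_open.
apply: filterS2 o c => _ [s ps <-]; rewrite /preimage/= chartK// => qs.
by exists s.
Qed.

Lemma hausdorff_prod (S T : topologicalType) :
  hausdorff_space S -> hausdorff_space T -> hausdorff_space (S * T)%type.
Proof.
move=> hS hT [a b] [c d] ab; congr pair.
  apply: hS => A B nA nB; have [] := ab (A `*` setT) (B `*` setT).
  - by exists (A, setT) => //; split=> //; exact: filterT.
  - by exists (B, setT) => //; split=> //; exact: filterT.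
  by move=> [x y] [[? _] [? _]]; exists x.
apply: hT => A B nA nB; have [] := ab (setT `*` A) (setT `*` B).
- by exists (setT, A) => //; split=> //; exact: filterT.
- by exists (setT, B) => //; split=> //; exact: filterT.
by move=> [x y] [[_ ?] [_ ?]]; exists y.
Qed.

Lemma open_setX (S T : topologicalType) (A : set S) (B : set T) :
  open A -> open B -> open (A `*` B).
Proof.
move=> oA oB; rewrite openE => -[x y] [/= Ax By].
by exists (A, B) => //; split; exact: open_nbhs_nbhs.
Qed.

Lemma second_countable_prod (S T : topologicalType) :
  @second_countable S -> @second_countable T -> @second_countable (S * T)%type.
Proof.
move=> [A cA [oA bA]] [B cB [oB bB]].
exists [set X | exists2 ab, (A `*` B) ab & X = ab.1 `*` ab.2].
  rewrite (_ : [set X | _] = (fun ab => ab.1 `*` ab.2) @` (A `*` B)).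
    by apply: (card_le_trans (card_image_le _ _)); exact: countableX.
  by apply/seteqP; split=> X [ab ? e]; exists ab.
split.
  by move=> _ [[a b] [/= Aa Bb] ->]; apply: open_setX; [exact: oA|exact: oB].
move=> [x y] X [[U V] [/= nU nV] UVX].
have [U' [AU' U'x] U'U] := bA x U nU.
have [V' [BV' V'y] V'V] := bB y V nV.
exists (U' `*` V'); first by split=> //; exists (U', V').
by move=> [s t] [/= Us Vt]; apply: UVX; split; [exact: U'U|exact: V'V].
Qed.

Variables (N1 : manifold R n1) (N2 : manifold R n2).
Let T : topologicalType := (N1 * N2)%type.

Definition prod_dom (z : T) : set T := chart_dom z.1 `*` chart_dom z.2.
Definition prod_chart (z w : T) : 'rV[R]_(n1 + n2) :=
  row_mx (chart z.1 w.1) (chart z.2 w.2).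
Definition prod_param (z : T) (x : 'rV[R]_(n1 + n2)) : T :=
  (param z.1 (lsubmx x), param z.2 (rsubmx x)).

Lemma prod_chart_img z (A : set N1) (B : set N2) :
  prod_chart z @` (A `*` B) = prod_set (chart z.1 @` A) (chart z.2 @` B).
Proof.
apply/seteqP; split=> [_ [[a b] [/= Aa Bb] <-]|x [[a Aa ax] [b Bb bx]]].
  by split; rewrite /prod_chart/= (row_mxKl, row_mxKr); [exists a|exists b].
by exists (a, b) => //; rewrite /prod_chart/= ax bx hsubmxK.
Qed.

Lemma prod_dom_open z : open (prod_dom z).
Proof. by apply: open_setX; exact: chart_dom_open. Qed.

Lemma prod_dom_self z : prod_dom z z.
Proof. by split; exact: chart_dom_self. Qed.

Lemma prod_chart_img_open z : open (prod_chart z @` prod_dom z).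
Proof. by rewrite prod_chart_img; apply: open_prod_set; exact: chart_img_open. Qed.

Lemma prod_chartK z w : prod_dom z w -> prod_param z (prod_chart z w) = w.
Proof.
case: w => a b [/= za zb].
by rewrite /prod_param /prod_chart row_mxKl row_mxKr/= !chartK.
Qed.

Lemma prod_chart_continuous z w : prod_dom z w ->
  {for w, continuous (prod_chart z)}.
Proof.
case: w => a b [/= z1 z2]; apply: (@row_mx_cvg _ _ _ _ (nbhs (a, b)) _
  (chart z.1 \o fst) (chart z.2 \o snd)).
  exact: (cvg_comp _ _ (@cvg_fst _ _ (nbhs a) (nbhs b) _) (chart_continuous z1)).
exact: (cvg_comp _ _ (@cvg_snd _ _ (nbhs a) (nbhs b) _) (chart_continuous z2)).
Qed.

Lemma prod_param_continuous z w : prod_dom z w ->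
  {for prod_chart z w, continuous (prod_param z)}.
Proof.
move=> [z1 z2]; have := param_continuous z2; have := param_continuous z1.
rewrite -[chart z.1 _](row_mxKl _ (chart z.2 w.2)).
rewrite -{2}[chart z.2 _](row_mxKr (chart z.1 w.1)) => c1 c2.
have d1 := cvg_comp _ _ (@continuous_lsubmx _ _ _ _ (prod_chart z w)) c1.
have d2 := cvg_comp _ _ (@continuous_rsubmx _ _ _ _ (prod_chart z w)) c2.
exact: (@cvg_pair _ _ _ (nbhs (prod_chart z w))
  (nbhs (param z.1 (lsubmx (prod_chart z w))))
  (nbhs (param z.2 (rsubmx (prod_chart z w)))) _ _ _ _ _ d1 d2).
Qed.

Lemma prod_transition_smooth z w :
  smooth_on (prod_chart z @` (prod_dom z `&` prod_dom w))
    (prod_chart w \o prod_param z).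
Proof.
move=> k; rewrite /prod_dom -setXI prod_chart_img.
exact: (prod_fun_Ck (@transition_open _ N1 z.1 w.1)
  (@transition_open _ N2 z.2 w.2)
  (@transition_smooth _ _ N1 z.1 w.1 k) (@transition_smooth _ _ N2 z.2 w.2 k)).
Qed.

Definition prod_manifold : manifold R (n1 + n2) :=
  @Manifold R (n1 + n2) T prod_dom prod_chart prod_param
    (hausdorff_prod (@manifold_hausdorff _ _ N1) (@manifold_hausdorff _ _ N2))
    (second_countable_prod (@manifold_second_countable _ _ N1)
       (@manifold_second_countable _ _ N2))
    prod_dom_open prod_dom_self prod_chart_img_open prod_chartK
    prod_chart_continuous prod_param_continuous prod_transition_smooth.

End ProductManifold.

Section VectorFields.
Context {R : realType} {n : nat} {M : manifold R n}.

(* The tangent space at p is 'rV[R]_n : a tangent vector is given by its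
   components in the preferred chart `chart p`. A vector field assigns to each
   q its components in `chart q`, and `field_coord X p` gives the components of
   X in the fixed chart `chart p`, as functions of the coordinates. *)
Definition vfield := M -> 'rV[R]_n.

Definition field_coord (X : vfield) (p : M) : 'rV[R]_n -> 'rV[R]_n :=
  fun x => let q := param p x in 'D_(X q) (chart p \o param q) (chart q q).

Definition smooth_field_at (X : vfield) (p : M) :=
  smooth_at (field_coord X p) (chart p p).

Definition smooth_fun_at (h : M -> R) (p : M) :=
  smooth_at (V := R^o) (h \o param p) (chart p p).

Definition dfun (h : M -> R) (p : M) (v : 'rV[R]_n) : R :=
  'D_v (h \o param p : 'rV[R]_n -> R^o) (chart p p).

Definition bracket (X Y : vfield) : vfield := fun p =>
  'D_(X p) (field_coord Y p) (chart p p) - 'D_(Y p) (field_coord X p) (chart p p).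

End VectorFields.
Arguments vfield {R n} M.

Section Maps.
Context {R : realType} {n m : nat} {N : manifold R n} {M : manifold R m}.

Definition dmap (F : N -> M) (p : N) (v : 'rV[R]_n) : 'rV[R]_m :=
  'D_v (chart (F p) \o F \o param p) (chart p p).

Definition smooth_map (F : N -> M) := forall p,
  {for p, continuous F} /\ smooth_at (chart (F p) \o F \o param p) (chart p p).

Definition is_submanifold (F : N -> M) :=
  [/\ smooth_map F, injective F & forall p, injective (dmap F p)].

End Maps.

(* Smoothness of a tensor field is smoothness of its values on smooth vector
   fields. Vector fields are only required to be smooth near the point under
   consideration, i.e. they are local vector fields. *)
Record metric {R : realType} {n : nat} (M : manifold R n) := Metric {
  inner :> M -> 'rV[R]_n -> 'rV[R]_n -> R;
  inner_linear : forall p a u v w,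
    inner p (a *: u + v) w = a * inner p u w + inner p v w;
  inner_sym : forall p u v, inner p u v = inner p v u;
  inner_gt0 : forall p u, u != 0 -> 0 < inner p u u;
  inner_smooth : forall p (X Y : vfield M),
    smooth_field_at X p -> smooth_field_at Y p ->
    smooth_fun_at (fun q => inner q (X q) (Y q)) p
}.

(* `nabla X Y` is the covariant derivative of Y along X; the axioms at p concern
   fields that are smooth near p, so the values of `nabla` on other fields are
   irrelevant. *)
Record is_levi_civita {R : realType} {n : nat} {M : manifold R n}
    (g : metric M) (nabla : vfield M -> vfield M -> vfield M) : Prop :=
  LeviCivita {
  nabla_smooth : forall (X Y : vfield M) p,
    smooth_field_at X p -> smooth_field_at Y p -> smooth_field_at (nabla X Y) p;
  nabla_linear : forall (h : M -> R) (X Y Z : vfield M) p,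
    smooth_fun_at h p -> smooth_field_at X p -> smooth_field_at Y p ->
    smooth_field_at Z p ->
    nabla (fun q => h q *: X q + Y q) Z p = h p *: nabla X Z p + nabla Y Z p;
  nabla_add : forall (X Y Z : vfield M) p,
    smooth_field_at X p -> smooth_field_at Y p -> smooth_field_at Z p ->
    nabla X (fun q => Y q + Z q) p = nabla X Y p + nabla X Z p;
  nabla_leibniz : forall (h : M -> R) (X Y : vfield M) p,
    smooth_fun_at h p -> smooth_field_at X p -> smooth_field_at Y p ->
    nabla X (fun q => h q *: Y q) p = dfun h p (X p) *: Y p + h p *: nabla X Y p;
  nabla_torsion_free : forall (X Y : vfield M) p,
    smooth_field_at X p -> smooth_field_at Y p ->
    nabla X Y p - nabla Y X p = bracket X Y p;
  nabla_metric : forall (X Y Z : vfield M) p,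
    smooth_field_at X p -> smooth_field_at Y p -> smooth_field_at Z p ->
    dfun (fun q => g q (Y q) (Z q)) p (X p) =
      g p (nabla X Y p) (Z p) + g p (Y p) (nabla X Z p)
}.

Record almost_contact_metric {R : realType} {m : nat}
    (M : manifold R (2 * m + 1)) := AlmostContactMetric {
  acm_g :> metric M;
  phi : M -> {linear 'rV[R]_(2 * m + 1) -> 'rV[R]_(2 * m + 1)};
  xi : vfield M;
  eta : M -> {scalar 'rV[R]_(2 * m + 1)};
  phi_smooth : forall p (X : vfield M),
    smooth_field_at X p -> smooth_field_at (fun q => phi q (X q)) p;
  xi_smooth : forall p, smooth_field_at xi p;
  eta_smooth : forall p (X : vfield M),
    smooth_field_at X p -> smooth_fun_at (fun q => eta q (X q)) p;
  phi_sq : forall p u, phi p (phi p u) = - u + eta p u *: xi p;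
  phi_xi : forall p, phi p (xi p) = 0;
  eta_phi : forall p u, eta p (phi p u) = 0;
  eta_xi : forall p, eta p (xi p) = 1;
  etaE : forall p u, eta p u = acm_g p u (xi p);
  phi_inner : forall p u v,
    acm_g p (phi p u) (phi p v) = acm_g p u v - eta p u * eta p v
}.

Section NearlyTransSasakian.
Context {R : realType} {m : nat} {M : manifold R (2 * m + 1)}.
Variables (S : almost_contact_metric M) (nabla : vfield M -> vfield M -> vfield M).

Definition nabla_phi (X Y : vfield M) : vfield M := fun p =>
  nabla X (fun q => phi S q (Y q)) p - phi S p (nabla X Y p).

Definition nearly_trans_sasakian (alpha beta : M -> R) :=
  forall (X Y : vfield M) p, smooth_field_at X p -> smooth_field_at Y p ->
    nabla_phi X Y p + nabla_phi Y X p =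
      alpha p *: ((2 * S p (X p) (Y p)) *: xi S p
                  - eta S p (Y p) *: X p - eta S p (X p) *: Y p)
      - beta p *: (eta S p (Y p) *: phi S p (X p) + eta S p (X p) *: phi S p (Y p)).

End NearlyTransSasakian.

(* theta is the angle between u and its orthogonal projection w on V. *)
Definition subspace_angle {R : realType} {n : nat} (b : 'rV[R]_n -> 'rV[R]_n -> R)
    (V : set 'rV[R]_n) (u : 'rV[R]_n) (theta : R) :=
  exists w, [/\ V w, forall v, V v -> b (u - w) v = 0 &
    theta = acos (Num.sqrt (b w w) / Num.sqrt (b u u))].

Section SemiSlant.
Context {R : realType} {m n1 n2 : nat} {M : manifold R (2 * m + 1)}
  {N1 : manifold R n1} {N2 : manifold R n2}.
Variables (S : almost_contact_metric M) (g1 : metric N1) (g2 : metric N2)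
  (f : N1 -> R) (iota : prod_manifold N1 N2 -> M) (theta : R).

Let pi1 : prod_manifold N1 N2 -> N1 := fst.
Let pi2 : prod_manifold N1 N2 -> N2 := snd.

Definition warped_inner (z : prod_manifold N1 N2) (u v : 'rV[R]_(n1 + n2)) : R :=
  g1 (pi1 z) (dmap pi1 z u) (dmap pi1 z v)
  + f (pi1 z) ^+ 2 * g2 (pi2 z) (dmap pi2 z u) (dmap pi2 z v).

(* The tangent spaces at iota z of the leaves of the two factors through z:
   the leaf of N1 is tangent to the kernel of d(pi2), and conversely. *)
Definition tangent1 z : set 'rV[R]_(2 * m + 1) :=
  dmap iota z @` [set u | dmap pi2 z u = 0].
Definition tangent2 z : set 'rV[R]_(2 * m + 1) :=
  dmap iota z @` [set u | dmap pi1 z u = 0].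

Record warped_product_semi_slant : Prop := WarpedProductSemiSlant {
  factor1_dim : (0 < n1)%N;
  factor2_dim : (0 < n2)%N;
  warping_smooth : forall p, smooth_fun_at f p;
  warping_gt0 : forall p, 0 < f p;
  submanifold : is_submanifold iota;
  xi_tangent : forall z, range (dmap iota z) (xi S (iota z));
  induced_metric : forall z u v,
    S (iota z) (dmap iota z u) (dmap iota z v) = warped_inner z u v;
  factor2_invariant : forall z u, tangent2 z u -> tangent2 z (phi S (iota z) u);
  slant_angle : 0 < theta < pi / 2;
  factor1_slant : forall z u, tangent1 z u -> u != 0 ->
    (forall c, u != c *: xi S (iota z)) ->
    subspace_angle (S (iota z)) (tangent1 z) (phi S (iota z) u) theta
}.

End SemiSlant.

(* Main.v *)
Require Import Defs.
From mathcomp Require Import all_boot all_order all_algebra.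
From mathcomp Require Import all_classical all_reals all_analysis.
From mathcomp Require Import ring lra.
Import Order.TTheory GRing.Theory Num.Theory.
Import numFieldNormedType.Exports.
Local Open Scope classical_set_scope.
Local Open Scope ring_scope.

(** Why the theorem holds: the leaves of N_T are integral manifolds of the
    distribution eta = 0, whereas a nearly trans-Sasakian structure makes
    d eta non-degenerate on the phi-invariant planes in that distribution
    wherever alpha <> 0.

    Fix a point z and a nonzero vector u tangent at iota z to the leaf of N_T.
    The two factors of a warped product are orthogonal and xi is tangent to
    the first one, so eta vanishes on all tangent vectors of the leaves of N_T
    ([eta_tangent2]). Invariance puts v = phi u in the same tangent space.
    The computation of d eta (u, v) goes two ways.

    - From the structure equation with X = Y and eta X = 0, paired with xi: the
      terms in beta vanish and one gets
      g (phi X, nabla_X xi) = - alpha |X|^2 ([nabla_xi_phi]). Applied to u and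
      to v, with phi v = - u and |v| = |u|, and since nabla is metric and
      torsion free ([exterior_derivative_eta]),
      d eta (u, v) = g (nabla_u xi, v) - g (nabla_v xi, u) = - 2 alpha |u|^2.

    - From the leaf: the pullback of eta to it is zero, and exterior
      differentiation commutes with pullback, so d eta (u, v) = 0
      ([pullback_closed]). In coordinates this is the symmetry of second
      derivatives ([derive_derive_comm]).

    Hence alpha |u|^2 = 0 at iota z. The forms are only ever handled through
    coordinate vector fields: [coord_field p v] extends the tangent vector v at
    p with constant components in the chart at p, so that these fields commute
    and the terms in the Lie bracket drop out. *)

(** * Symmetry of second directional derivatives *)
Lemma derive_comp {R : realType} {U V W : normedModType R} (f : U -> V)
    (g : V -> W) x v :
  differentiable f x -> differentiable g (f x) ->
  'D_v (g \o f) x = 'D_('D_v f x) g (f x).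
Proof.
move=> df dg; have dgf := differentiable_comp df dg.
by rewrite (deriveE _ dgf) (deriveE _ df) (deriveE _ dg) diff_comp.
Qed.

Lemma is_derive_line {R : realType} {V W : normedModType R} (g : V -> W)
    (b e : V) (s : R) :
  derivable g (s *: e + b) e ->
  is_derive s 1 (fun r : R => g (r *: e + b)) ('D_e g (s *: e + b)).
Proof.
have E : (fun h : R => h^-1 *: (g ((h *: 1 + s) *: e + b) - g (s *: e + b))) =
    (fun h => h^-1 *: (g (h *: e + (s *: e + b)) - g (s *: e + b))).
  by apply/funext => h; rewrite [h *: 1]mulr1 scalerDl addrA.
by move=> dg; split; rewrite /derivable /derive E.
Qed.

(** Two applications of the mean value theorem, first along e, then along e'.
    The second difference on the left is symmetric in e and e'; this is what
    makes the two iterated derivatives comparable. *)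
Lemma mixed_difference {R : realType} {V : normedModType R} (h : V -> R^o)
    (a e e' : V) (t : R) : 0 < t ->
  (forall s r, 0 <= s <= t -> 0 <= r <= t ->
     differentiable h (s *: e + (r *: e' + a)) /\
     differentiable ('D_e h) (s *: e + (r *: e' + a))) ->
  exists s r, [/\ 0 <= s <= t, 0 <= r <= t &
    h (t *: e + (t *: e' + a)) - h (t *: e + a) - h (t *: e' + a) + h a =
    t ^+ 2 * 'D_e' ('D_e h) (s *: e + (r *: e' + a))].
Proof.
move=> t0 dh.
have tt : 0 <= t <= t by rewrite lexx ltW.
have t00 : 0 <= (0 : R) <= t by rewrite lexx ltW.
have dh0 s : 0 <= s <= t -> differentiable h (s *: e + a).
  by move=> st; have [+ _] := dh s 0 st t00; rewrite scale0r add0r.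
pose k s := h (s *: e + (t *: e' + a)) - h (s *: e + a).
pose k' s := 'D_e h (s *: e + (t *: e' + a)) - 'D_e h (s *: e + a).
have dk s : 0 <= s <= t -> is_derive s 1 k (k' s).
  move=> st; apply: is_deriveB; apply: is_derive_line; apply: diff_derivable.
    by have [] := dh s t st tt.
  exact: dh0.
(* The second difference is the increment of k over [0, t]. *)
have [s] : exists2 s, s \in `]0, t[%R & k t - k 0 = k' s * (t - 0).
  apply: (MVT t0) => [s|].
    by rewrite in_itv/= => /andP[? ?]; apply: dk; rewrite !ltW.
  apply: derivable_within_continuous => s; rewrite in_itv/= => st.
  by have [] := dk s st.
rewrite in_itv/= => /andP[s0 s1]; rewrite {1 2}/k !scale0r !add0r subr0 => E1.
have st : 0 <= s <= t by rewrite !ltW.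
pose l r := 'D_e h (r *: e' + (s *: e + a)).
have dl r : 0 <= r <= t -> is_derive r 1 l ('D_e' ('D_e h) (r *: e' + (s *: e + a))).
  move=> rt; apply: is_derive_line; apply: diff_derivable.
  by rewrite addrCA; have [] := dh s r st rt.
have [r] : exists2 r, r \in `]0, t[%R &
    l t - l 0 = 'D_e' ('D_e h) (r *: e' + (s *: e + a)) * (t - 0).
  apply: (MVT t0) => [r|].
    by rewrite in_itv/= => /andP[? ?]; apply: dl; rewrite !ltW.
  apply: derivable_within_continuous => r; rewrite in_itv/= => rt.
  by have [] := dl r rt.
rewrite in_itv/= => /andP[r0 r1]; rewrite /l scale0r add0r subr0 addrCA => E2.
exists s, r; split; rewrite ?ltW//.
move: E1; rewrite /k' E2 -[_ *: _ + (r *: _ + _)]addrCA => E1.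
have -> : forall x y z w : R^o, x - y - z + w = x - y - (z - w) by move=> *; ring.
by rewrite E1 expr2 mulrC mulrA mulrC [_ * t]mulrC mulrCA mulrA.
Qed.

Lemma nbhs_square {R : realType} {V : normedModType R} (a e e' : V) (P : set V) :
  nbhs a P -> exists2 t : R, 0 < t & forall s r, 0 <= s <= t -> 0 <= r <= t ->
    P (s *: e + (r *: e' + a)).
Proof.
move=> /nbhs_ballP[d /= d0 dP]; have n0 : 0 < `|e| + `|e'| + 1 by rewrite ltr_wpDl ?addr_ge0.
exists (d / (`|e| + `|e'| + 1)); first exact: divr_gt0.
move=> s r /andP[s0 st] /andP[r0 rt]; apply: dP; rewrite -ball_normE /ball_/=.
rewrite addrA opprD addrCA subrr addr0 normrN.
apply: (le_lt_trans (ler_normD _ _)); rewrite !normrZ !ger0_norm//.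
apply: (@le_lt_trans _ _ (d / (`|e| + `|e'| + 1) * (`|e| + `|e'|))).
  by rewrite mulrDr lerD// ler_wpM2r.
by rewrite mulrAC ltr_pdivrMr// ltr_pM2l// ltrDl.
Qed.

(** Schwarz: both iterated derivatives, taken at nearby points, equal the same
    second difference divided by t^2, and both are continuous at a. If they
    differed at a, a square so small that each stays within half of the gap
    would give a contradiction. *)
Lemma derive_derive_comm {R : realType} {n : nat} (U : set 'rV[R]_n)
    (h : 'rV[R]_n -> R^o) a e e' :
  open U -> U a -> Ck 2 U h -> 'D_e' ('D_e h) a = 'D_e ('D_e' h) a.
Proof.
move=> oU Ua [dh Dh]; apply/eqP; rewrite -subr_eq0 -normr_le0 leNgt; apply/negP => lt0.
set A := 'D_e' ('D_e h) a in lt0 *; set B := 'D_e ('D_e' h) a in lt0 *.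
have nU : nbhs a U by exact: open_nbhs_nbhs.
have nA : \forall y \near a, `|A - 'D_e' ('D_e h) y| < `|A - B| / 2.
  by have /cvgrPdist_lt := (Dh e).2 e' a Ua; apply; exact: divr_gt0.
have nB : \forall y \near a, `|'D_e ('D_e' h) y - B| < `|A - B| / 2.
  by have /cvgrPdistC_lt := (Dh e').2 e a Ua; apply; exact: divr_gt0.
have [t t0 near_a] := nbhs_square a e e' _ (filterI nU (filterI nA nB)).
have d1 s r : 0 <= s <= t -> 0 <= r <= t ->
    differentiable h (s *: e + (r *: e' + a)) /\
    differentiable ('D_e h) (s *: e + (r *: e' + a)).
  by move=> st rt; have [Ux _] := near_a s r st rt; split; [exact: dh|exact: (Dh e).1].
have d2 r s : 0 <= r <= t -> 0 <= s <= t ->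
    differentiable h (r *: e' + (s *: e + a)) /\
    differentiable ('D_e' h) (r *: e' + (s *: e + a)).
  move=> rt st; rewrite addrCA.
  by have [Ux _] := near_a s r st rt; split; [exact: dh|exact: (Dh e').1].
have [s1 [r1 [s1t r1t E1]]] := mixed_difference h a e e' t t0 d1.
have [r2 [s2 [r2t s2t E2]]] := mixed_difference h a e' e t t0 d2.
have [_ [lA _]] := near_a _ _ s1t r1t; have [_ [_]] := near_a _ _ s2t r2t.
rewrite addrCA => lB.
have E : t ^+ 2 * 'D_e' ('D_e h) (s1 *: e + (r1 *: e' + a)) =
         t ^+ 2 * 'D_e ('D_e' h) (r2 *: e' + (s2 *: e + a)).
  apply: (etrans (esym E1)); apply: (etrans _ E2).
  rewrite [t *: e + (t *: e' + a)]addrCA; congr (_ + _); exact: addrAC.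
move/(mulfI (lt0r_neq0 (exprn_gt0 2 t0))): E => E.
move: lA lB; rewrite E; set C := 'D_e _ _ => lA lB.
have := le_lt_trans (ler_distD C A B) (ltrD lA lB).
by rewrite -splitr ltxx.
Qed.

(** * Coordinate vector fields *)

Section CoordinateFields.
Context {R : realType} {n : nat} {M : manifold R n}.

(** The tangent space at q is modelled on the preferred chart at q, hence the
    transition map: the field has the constant components v in the chart at
    p. *)
Definition coord_field (p : M) (v : 'rV[R]_n) : vfield M :=
  fun q => 'D_v (chart q \o param p) (chart p q).

Lemma nbhs_chart_img (p q : M) : chart_dom p q ->
  nbhs (chart p q) [set chart p r | r in chart_dom p].
Proof. by move=> pq; apply: open_nbhs_nbhs; split; [exact: chart_img_open|exists q]. Qed.

Lemma transition_differentiable (p q r : M) : chart_dom p r -> chart_dom q r ->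
  differentiable (chart q \o param p) (chart p r).
Proof. by move=> pr qr; have [d _] := transition_smooth p q 1; apply: d; exists r. Qed.

Lemma near_param_chart (p q r : M) : chart_dom p r -> chart_dom q r ->
  \forall x \near chart p r, param q (chart q (param p x)) = param p x.
Proof.
move=> pr qr.
have : nbhs (chart p r) [set chart p s | s in chart_dom p `&` chart_dom q].
  by apply: open_nbhs_nbhs; split; [exact: transition_open|exists r].
by apply: filterS => _ [s [ps qs] <-]; rewrite !chartK.
Qed.

Lemma field_coord_coord_field (p q : M) (v : 'rV[R]_n) : chart_dom p q ->
  field_coord (coord_field p v) p (chart p q) = v.
Proof.
move=> pq; rewrite /field_coord chartK// /coord_field.
have qq := chart_dom_self q.
have E : chart q q = (chart q \o param p) (chart p q) by rewrite /= chartK.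
rewrite {1}E -derive_comp; last 2 first.
- exact: transition_differentiable.
- by rewrite -E; exact: transition_differentiable.
rewrite -[RHS](derive_id (chart p q)); apply: near_eq_derive.
have : nbhs (chart p q) [set chart p s | s in chart_dom p `&` chart_dom q].
  by apply: open_nbhs_nbhs; split; [exact: transition_open|exists q].
by apply: filterS => _ [s [ps qs] <-] /=; rewrite !chartK.
Qed.

Lemma coord_field_self (p : M) v : coord_field p v p = v.
Proof.
have pp := chart_dom_self p; rewrite /coord_field.
rewrite -[RHS](derive_id (chart p p)); apply: near_eq_derive.
by apply: filterS (nbhs_chart_img p p pp) => _ [s ps <-] /=; rewrite chartK.
Qed.

Lemma near_field_coord (p : M) v :
  \forall x \near chart p p, field_coord (coord_field p v) p x = v.
Proof.
apply: filterS (nbhs_chart_img p p (chart_dom_self p)) => _ [s ps <-].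
exact: field_coord_coord_field.
Qed.

Lemma Ck_cst {V : normedModType R} k (U : set 'rV[R]_n) (c : V) : Ck k U (cst c).
Proof.
elim: k c => [c x _|k IH c]; first exact: cst_continuous.
split=> [x _|v]; first exact: differentiable_cst.
by rewrite (_ : 'D_v _ = cst 0) //; apply/funext => x; rewrite derive_cst.
Qed.

Lemma coord_field_smooth (p : M) v : smooth_field_at (coord_field p v) p.
Proof.
exists [set chart p s | s in chart_dom p]; split.
- exact: chart_img_open.
- by exists p => //; exact: chart_dom_self.
move=> k; apply: (Ck_ext (f := cst v)); last exact: Ck_cst.
  exact: chart_img_open.
by move=> _ /set_mem[q pq <-]; rewrite field_coord_coord_field.
Qed.

(** The components in the chart at p are constant near p, so both terms of the
    bracket differentiate a constant. *)
Lemma bracket_coord_field (p : M) v w :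
  bracket (coord_field p v) (coord_field p w) p = 0.
Proof.
rewrite /bracket; have E u u' : 'D_u (field_coord (coord_field p u') p) (chart p p) = 0.
  rewrite -[RHS](derive_cst u' (chart p p) u); apply: near_eq_derive.
  exact: near_field_coord.
by apply/eqP; rewrite subr_eq0; apply/eqP/(etrans (E _ _))/esym/E.
Qed.

(** Lets a 1-form be evaluated on coordinate fields through finitely many
    coefficient functions, to which the product rule applies. *)
Lemma coord_field_sum (p q : M) (v : 'rV[R]_n) : chart_dom p q ->
  coord_field p v q = \sum_i v 0 i *: coord_field p 'e_i q.
Proof.
move=> pq; have d := transition_differentiable p q q pq (chart_dom_self q).
rewrite /coord_field (deriveE _ d) {1}[v]row_sum_delta linear_sum.
by apply: eq_bigr => i _; rewrite linearZ (deriveE _ d).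
Qed.

End CoordinateFields.

(** * Smooth maps in coordinates *)

Section MapsInCoordinates.
Context {R : realType} {n m : nat} {N : manifold R n} {M : manifold R m}.
Variables (F : N -> M) (z : N).
Hypothesis smF : smooth_map F.

Lemma smooth_map_differentiable w : differentiable (chart (F w) \o F \o param w) (chart w w).
Proof. by have [_ [U [oU Uz sU]]] := smF w; have [d _] := sU 1%N; exact: d. Qed.

Lemma near_smooth_map_dom :
  \forall x \near chart z z, chart_dom (F z) (F (param z x)).
Proof.
have zz := chart_dom_self z.
have nF : nbhs z (F @^-1` chart_dom (F z)).
  apply: (proj1 (smF z)); apply: open_nbhs_nbhs.
  by split; [exact: chart_dom_open|exact: chart_dom_self].
change (nbhs (chart z z) (param z @^-1` (F @^-1` chart_dom (F z)))).
by apply: (param_continuous zz); rewrite chartK.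
Qed.

(** The differential [dmap] refers, at each point w near z, to the preferred
    charts at w and F w. Read in the fixed charts at z and F z it is the ordinary
    derivative of the coordinate expression of F, which can then be
    differentiated once more. Both sides are, by the chain rule, the derivative
    along e of F read in the charts at z and F w. *)
Lemma near_dmap_coord_field : \forall x \near chart z z, forall e,
  coord_field (F z) ('D_e (chart (F z) \o F \o param z) x) (F (param z x)) =
    dmap F (param z x) (coord_field z e (param z x)).
Proof.
have [_ [U [oU Uz sU]]] := smF z; have [dJ _] := sU 1%N.
have nU : nbhs (chart z z) U by exact: open_nbhs_nbhs.
apply: filterS3 nU (near_join near_smooth_map_dom)
  (nbhs_chart_img z z (chart_dom_self z)) => x Ux domx [w zw wx] e.
have Jx : (chart (F z) \o F \o param z) x = chart (F z) (F w).
  by rewrite /= -wx chartK.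
have Fw : chart_dom (F z) (F w).
  by have := nbhs_singleton domx; rewrite -wx chartK.
have wE : chart w w = (chart w \o param z) x by rewrite /= -wx chartK.
have ww := chart_dom_self w.
have px : param z x = w by rewrite -wx chartK.
rewrite px /coord_field -Jx -derive_comp; last 2 first.
- exact: dJ.
- by rewrite Jx; apply: transition_differentiable => //; exact: chart_dom_self.
rewrite /dmap wE wx -derive_comp; last 2 first.
- by rewrite -wx; exact: transition_differentiable.
- by rewrite -wE; exact: smooth_map_differentiable.
apply: near_eq_derive.
have := near_param_chart z w w zw ww; rewrite wx; apply: filterS2 domx => y domy yE /=.
by rewrite yE chartK.
Qed.

End MapsInCoordinates.

(** * The pullback of a 1-form vanishing along two coordinate directions *)

Lemma derive_coord {R : realType} {V : normedModType R} {n : nat}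
    (f : V -> 'rV[R]_n) x v i :
  differentiable f x -> 'D_v (fun y => f y 0 i : R^o) x = 'D_v f x 0 i.
Proof.
by move=> df; rewrite [in RHS]derive_mx ?mxE//; exact: diff_derivable.
Qed.

Lemma Ck_coord {R : realType} {n m : nat} k (U : set 'rV[R]_n)
    (f : 'rV[R]_n -> 'rV[R]_m) i :
  open U -> Ck k U f -> Ck k U (fun x => f x 0 i : R^o).
Proof.
move=> oU; elim: k f => [|k IH] f.
  move=> cf x Ux; exact: (cvg_comp _ _ (cf x Ux) (@coord_continuous _ _ _ 0 i (f x))).
move=> [df Df]; split=> [x Ux|v].
  exact: (differentiable_comp (df x Ux) (differentiable_coord (f x) 0 i)).
apply: Ck_ext (IH _ (Df v)) => // x /set_mem Ux.
by rewrite derive_coord//; exact: df.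
Qed.

Definition form_coef {R : realType} {m : nat} {M : manifold R m}
    (omega : M -> {scalar 'rV[R]_m}) (p : M) (w : 'rV[R]_m) : M -> R :=
  fun q => omega q (coord_field p w q).

Section PullbackClosed.
Context {R : realType} {n m : nat} {N : manifold R n} {M : manifold R m}.
Variables (F : N -> M) (z : N) (omega : M -> {scalar 'rV[R]_m}).
Hypothesis smF : smooth_map F.
Hypothesis smw : forall p (X : vfield M),
  smooth_field_at X p -> smooth_fun_at (fun q => omega q (X q)) p.

Let p := F z.
Let J := chart p \o F \o param z.
Let x0 := chart z z.
Let Ji i x : R^o := J x 0 i.
Let a i : 'rV[R]_m -> R^o := form_coef omega p 'e_i \o param p.

Let J0 : J x0 = chart p p.
Proof. by rewrite /J/= chartK//; exact: chart_dom_self. Qed.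

Let form_coef_differentiable w :
  differentiable (form_coef omega p w \o param p : _ -> R^o) (chart p p).
Proof.
have [U [oU Uz sU]] := smw p _ (coord_field_smooth p w).
by have [d _] := sU 1%N; exact: d.
Qed.

Lemma dfun_form_coef w v :
  dfun (form_coef omega p w) p v = \sum_i w 0 i * 'D_v (a i) (chart p p).
Proof.
rewrite /dfun.
have E : \forall y \near chart p p, (form_coef omega p w \o param p : _ -> R^o) y =
     (\sum_i (w 0 i \*: a i)) y.
  apply: filterS (nbhs_chart_img p p (chart_dom_self p)) => _ [q pq <-].
  rewrite /= chartK// /form_coef coord_field_sum// linear_sum fct_sumE.
  by apply: eq_bigr => i _; rewrite linearZ /a /= chartK.
rewrite (near_eq_derive v E) derive_sum => [|i].
  apply: eq_bigr => i _; rewrite deriveZ//; apply: diff_derivable.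
  exact: form_coef_differentiable.
apply: derivableZ; apply: diff_derivable; exact: form_coef_differentiable.
Qed.

(** Near z the vanishing of omega on the image of e reads
    sum_i D_e J_i * (a_i o J) = 0, where J is F in coordinates and the a_i are
    the coefficients of omega. Its derivative along e' has two parts: the one
    in which a_i is differentiated is the left-hand side, the other one
    carries the second derivatives of J. *)
Lemma dfun_form_coef_vanishing e e' :
  (\forall x \near chart z z,
     omega (F (param z x)) (dmap F (param z x) (coord_field z e (param z x))) = 0) ->
  dfun (form_coef omega p (dmap F z e)) p (dmap F z e') =
    - \sum_i a i (chart p p) * 'D_e' ('D_e (Ji i)) x0.
Proof.
move=> w0; rewrite dfun_form_coef; apply/eqP; rewrite -subr_eq0 opprK; apply/eqP.
have [_ [U [oU Uz sU]]] := smF z; have nU : nbhs x0 U by exact: open_nbhs_nbhs.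
have [dJ _] := sU 1%N; have cJi i : Ck 2 U (Ji i) by exact: Ck_coord.
pose T i : 'rV[R]_n -> R^o := 'D_e (Ji i) * (a i \o J).
have T0 : \forall x \near x0, (\sum_i T i) x = cst (0 : R^o) x.
  apply: filterS3 nU (near_dmap_coord_field F z smF)
    (filterI w0 (near_smooth_map_dom F z smF)) => x Ux wE [wx dx].
  rewrite fct_sumE; apply: (etrans _ wx).
  rewrite -wE coord_field_sum// linear_sum; apply: eq_bigr => i _.
  rewrite linearZ; change (T i x) with ('D_e (Ji i) x * a i (J x)).
  rewrite derive_coord; last exact: dJ.
  by congr (_ * _); rewrite /a /J /form_coef /= chartK.
have dDJ i : differentiable ('D_e (Ji i)) x0 by exact: (((cJi i).2 e).1 x0 Uz).
have daJ i : differentiable (a i \o J) x0.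
  apply: differentiable_comp; first exact: dJ.
  by rewrite J0; exact: form_coef_differentiable.
rewrite -[RHS](derive_cst (0 : R^o) x0 e') -(near_eq_derive _ T0).
rewrite derive_sum => [|i]; last by apply: derivableM; exact: diff_derivable.
rewrite -big_split; apply: eq_bigr => i _ /=.
rewrite /T deriveM; [|exact: diff_derivable|exact: diff_derivable].
rewrite derive_comp; [|exact: dJ|by rewrite J0; exact: form_coef_differentiable].
have -> : 'D_e (Ji i) x0 = 'D_e J x0 0 i by apply: derive_coord; exact: dJ.
by rewrite /comp -/(J x0) J0.
Qed.

(** Since coordinate fields commute, the two sides differ by d omega (u, u').
    Each is the same expression in the second derivatives of F, with e and e'
    exchanged, so their symmetry gives the claim. *)
Lemma pullback_closed e e' u u' :
  (\forall x \near chart z z,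
     omega (F (param z x)) (dmap F (param z x) (coord_field z e (param z x))) = 0) ->
  (\forall x \near chart z z,
     omega (F (param z x)) (dmap F (param z x) (coord_field z e' (param z x))) = 0) ->
  dmap F z e = u -> dmap F z e' = u' ->
  dfun (form_coef omega p u') p u = dfun (form_coef omega p u) p u'.
Proof.
move=> w0 w0' <- <-; apply/esym.
have E := dfun_form_coef_vanishing e e' w0.
have E' := dfun_form_coef_vanishing e' e w0'.
suff EE : \sum_i a i (chart p p) * 'D_e' ('D_e (Ji i)) x0 =
    \sum_i a i (chart p p) * 'D_e ('D_e' (Ji i)) x0.
  exact: (etrans E (etrans (congr1 -%R EE) (esym E'))).
have [_ [U [oU Uz sU]]] := smF z.
apply: eq_bigr => i _; apply: (congr1 (fun t => a i (chart p p) * t)).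
exact: derive_derive_comm oU Uz (Ck_coord 2 U J i oU (sU 2%N)).
Qed.

End PullbackClosed.

(** * The contact form of a nearly trans-Sasakian structure *)

Section Inner.
Context {R : realType} {n : nat} {M : manifold R n} (g : metric M).

Lemma inner0l p u : g p 0 u = 0.
Proof.
by rewrite -[0 in LHS]addr0 -[X in X + _](scaler0 _ (-1)) inner_linear mulN1r addNr.
Qed.

Lemma inner0r p u : g p u 0 = 0.
Proof. by rewrite inner_sym inner0l. Qed.

Lemma innerDl p u v w : g p (u + v) w = g p u w + g p v w.
Proof. by rewrite -{1}[u]scale1r inner_linear mul1r. Qed.

Lemma innerNl p u w : g p (- u) w = - g p u w.
Proof. by rewrite -scaleN1r -[_ *: _]addr0 inner_linear inner0l addr0 mulN1r. Qed.

End Inner.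

Lemma dfun_cst {R : realType} {n : nat} {M : manifold R n} (c : R) (p : M) v :
  dfun (fun=> c) p v = 0.
Proof. exact: (derive_cst (c : R^o)). Qed.

Section ContactForm.
Context {R : realType} {m : nat} {M : manifold R (2 * m + 1)}.
Variables (S : almost_contact_metric M) (nabla : vfield M -> vfield M -> vfield M).
Hypothesis hnabla : is_levi_civita S nabla.

(** With Y = X and eta X = 0, only 2 alpha |X|^2 survives from the right-hand side
    of the structure equation after pairing with xi, because phi takes its values
    in the kernel of eta. So g (nabla_X (phi X), xi) = alpha |X|^2, and
    differentiating g (phi X, xi) = 0 along X moves the derivative onto xi. *)
Lemma nabla_xi_phi (alpha beta : M -> R) (X : vfield M) p :
  nearly_trans_sasakian S nabla alpha beta ->
  smooth_field_at X p -> eta S p (X p) = 0 ->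
  S p (phi S p (X p)) (nabla X (xi S) p) = - (alpha p * S p (X p) (X p)).
Proof.
move=> hM sX eX; have /(congr1 (eta S p)) := hM X X p sX sX.
rewrite eX !scale0r addr0 scaler0 !subr0 scalerA !raddfD !raddfN/= linearZ/=.
rewrite eta_xi !eta_phi subr0 mulr1 etaE => E.
have := nabla_metric hnabla sX (phi_smooth S sX) (xi_smooth S p).
rewrite [X in dfun X](_ : _ = fun=> 0); last first.
  by apply/funext => q; rewrite -etaE eta_phi.
rewrite dfun_cst; lra.
Qed.

(** The right-hand side is d eta (X, Y); as eta is dual to xi, metric
    compatibility and torsion-freeness express it by the skew-symmetric part of
    the covariant derivative of xi. *)
Lemma exterior_derivative_eta (X Y : vfield M) p :
  smooth_field_at X p -> smooth_field_at Y p ->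
  S p (nabla X (xi S) p) (Y p) - S p (nabla Y (xi S) p) (X p) =
  dfun (fun q => eta S q (Y q)) p (X p) - dfun (fun q => eta S q (X q)) p (Y p)
  - eta S p (bracket X Y p).
Proof.
move=> sX sY.
have dE V W : smooth_field_at V p -> smooth_field_at W p ->
    dfun (fun q => eta S q (W q)) p (V p) =
    S p (nabla V W p) (xi S p) + S p (W p) (nabla V (xi S) p).
  move=> sV sW; rewrite -(nabla_metric hnabla sV sW (xi_smooth S p)).
  by apply: (congr1 (fun h => dfun h p (V p))); apply/funext => q; rewrite etaE.
rewrite (dE X Y)// (dE Y X)// -(nabla_torsion_free hnabla sX sY) etaE.
rewrite innerDl innerNl (inner_sym _ _ (Y p)) (inner_sym _ _ (X p)); ring.
Qed.

End ContactForm.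

(** * Tangent vectors of the leaves of a product *)

Section ProductLeaves.
Context {R : realType} {n1 n2 : nat} {N1 : manifold R n1} {N2 : manifold R n2}.

Lemma derive_lsubmx (x v : 'rV[R]_(n1 + n2)) : 'D_v lsubmx x = lsubmx v.
Proof.
rewrite deriveE; last exact: differentiable_lsubmx.
by rewrite diff_lin//; exact: continuous_lsubmx.
Qed.

Lemma dmap_fst (z : prod_manifold N1 N2) u :
  dmap (fst : prod_manifold N1 N2 -> N1) z u = lsubmx u.
Proof.
rewrite -(derive_lsubmx (chart z z)); apply: near_eq_derive.
have nz : nbhs (lsubmx (chart z z)) [set chart z.1 q | q in chart_dom z.1].
  by rewrite row_mxKl; exact: (nbhs_chart_img z.1 z.1 (chart_dom_self z.1)).
have nzx : nbhs (chart z z) (lsubmx @^-1` [set chart z.1 q | q in chart_dom z.1]).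
  exact: (@continuous_lsubmx _ _ _ _ (chart z z) _ nz).
by apply: filterS nzx => x [q zq qx]; rewrite /= -qx chartK.
Qed.

(** The transition maps of a product are products of transition maps, so a
    coordinate field that is tangent to the leaf of N2 at z is tangent to the
    leaves of N2 at all points of the chart. *)
Lemma dmap_fst_coord_field (z w : prod_manifold N1 N2) e :
  chart_dom z w -> lsubmx e = 0 -> lsubmx (coord_field z e w) = 0.
Proof.
move=> [zw1 zw2] e0; rewrite /coord_field.
rewrite (_ : chart w \o param z =
  prod_fun (chart w.1 \o param z.1) (chart w.2 \o param z.2)) //.
rewrite prod_fun_derive; first by rewrite row_mxKl e0 derive0.
- by rewrite row_mxKl; apply: transition_differentiable => //; exact: chart_dom_self.
- by rewrite row_mxKr; apply: transition_differentiable => //; exact: chart_dom_self.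
Qed.

End ProductLeaves.

(** The warped metric has no term mixing the two factors, so xi, being tangent
    to the first, is orthogonal to the second. *)
Lemma eta_tangent2 {R : realType} {m n1 n2 : nat} {M : manifold R (2 * m + 1)}
    {N1 : manifold R n1} {N2 : manifold R n2} (S : almost_contact_metric M)
    (g1 : metric N1) (g2 : metric N2) (f : N1 -> R)
    (iota : prod_manifold N1 N2 -> M) z u :
  (forall z u v, S (iota z) (dmap iota z u) (dmap iota z v) =
     warped_inner g1 g2 f z u v) ->
  tangent1 iota z (xi S (iota z)) -> tangent2 iota z u -> eta S (iota z) u = 0.
Proof.
move=> ind [b /= b0 bxi] [a /= a0 <-]; rewrite etaE -bxi ind /warped_inner.
by rewrite a0 b0 inner0l inner0r mulr0 addr0.
Qed.

Theorem theorem3p2 (R : realType) (m : nat) (M : manifold R (2 * m + 1))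
    (S : almost_contact_metric M) (nabla : vfield M -> vfield M -> vfield M)
    (hnabla : is_levi_civita S nabla) (alpha beta : M -> R)
    (halpha : forall p, smooth_fun_at alpha p)
    (hbeta : forall p, smooth_fun_at beta p)
    (hM : nearly_trans_sasakian S nabla alpha beta)
    (n1 n2 : nat) (N1 : manifold R n1) (N2 : manifold R n2)
    (g1 : metric N1) (g2 : metric N2) (f : N1 -> R)
    (iota : prod_manifold N1 N2 -> M) (theta : R)
    (hN : warped_product_semi_slant S g1 g2 f iota theta)
    (hxi : forall z, tangent1 iota z (xi S (iota z))) :
  forall z, alpha (iota z) = 0.
Proof.
move=> z; pose p := iota z; have [smi _ inji] := submanifold hN.
have eta0 w u : tangent2 iota w u -> eta S (iota w) u = 0.
  by apply: eta_tangent2 => //; exact: induced_metric hN.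
have leaf0 e : lsubmx e = 0 -> \forall x \near chart z z,
    eta S (iota (param z x))
      (dmap iota (param z x) (coord_field z e (param z x))) = 0.
  move=> e0; apply: filterS (nbhs_chart_img z z (chart_dom_self z)).
  move=> _ [w zw <-]; rewrite chartK//; apply: eta0.
  exists (coord_field z e w) => //=.
  by rewrite dmap_fst; exact: dmap_fst_coord_field.
(* As n2 > 0, the all-ones vector of the second factor is nonzero. *)
pose e : 'rV[R]_(n1 + n2) := row_mx 0 (const_mx 1).
have e0 : lsubmx e = 0 by exact: row_mxKl.
have eN0 : e != 0.
  apply/eqP => /(congr1 rsubmx) /rowP /(_ (Ordinal (factor2_dim hN))).
  by rewrite row_mxKr !mxE => /eqP; rewrite oner_eq0.
pose u := dmap iota z e; pose v := phi S p u.
have ut : tangent2 iota z u by exists e => //=; rewrite dmap_fst.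
have vt : tangent2 iota z v by exact: (factor2_invariant hN).
have uN0 : u != 0.
  apply/eqP => u0; move/eqP: eN0; apply; apply: (inji z).
  by rewrite -/u u0 /dmap derive0.
have [e' /=] := vt; rewrite dmap_fst => e'0 e'v.
have Eu := eta0 z u ut; have Ev := eta0 z v vt.
have [X [Y [sX sY [Xu Yv] XY0 dXY]]] : exists X Y : vfield M,
    [/\ smooth_field_at X p, smooth_field_at Y p, X p = u /\ Y p = v,
      bracket X Y p = 0 & dfun (fun q => eta S q (Y q)) p u =
        dfun (fun q => eta S q (X q)) p v].
  exists (coord_field p u), (coord_field p v).
  split; [exact: coord_field_smooth|exact: coord_field_smooth| | |].
  - by split; exact: coord_field_self.
  - exact: bracket_coord_field.
  - exact: (pullback_closed iota z (eta S) smi (eta_smooth S) e e' u v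
      (leaf0 e e0) (leaf0 e' e'0) erefl e'v).
(* It remains to compare the two values of d eta (u, v); phi v = - u and
   |v| = |u| because eta u = 0. *)
have := exterior_derivative_eta S nabla hnabla X Y p sX sY.
have := nabla_xi_phi S nabla hnabla alpha beta X p hM sX.
have := nabla_xi_phi S nabla hnabla alpha beta Y p hM sY.
rewrite Xu Yv XY0 dXY raddf0 !subrr => /(_ Ev) KY /(_ Eu) KX.
move: KY; rewrite phi_sq Eu scale0r addr0 innerNl phi_inner Eu mulr0 subr0.
move=> /oppr_inj KY; rewrite (inner_sym _ _ _ v) KX (inner_sym _ _ _ u) KY => /eqP.
have u_gt0 : 0 < S p u u by exact: inner_gt0.
rewrite -opprD oppr_eq0 -mulr2n mulrn_eq0/= mulf_eq0 (gt_eqF u_gt0) orbF.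
by move=> /eqP.
Qed.
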